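(* Fix $J\ge2$, $\alpha\in(0,1)$, $\Theta\ge1$, $\pi,b_T,b_C\in(0,1)$ and $\eta_T,\eta_C\in(0,1]$, and let data be generated by the process described in the context. Let $$\tilde\Gamma_b=\frac{b_T/(1-b_T)}{b_C/(1-b_C)},\qquad \tilde\Gamma_n=\frac{b_T/(1-b_T)}{b_C/(1-b_C)}\times\frac{\eta_T/\eta_C}{\Theta}$$ be the design sensitivities of the broad case test and of the narrow case test. Then the combined (Bonferroni) test has design sensitivity $\max(\tilde\Gamma_b,\tilde\Gamma_n)$: for $\Gamma\ge1$, as $I\to\infty$, the probability that the level-$\alpha$ combined test with parameters $(\Gamma,\Theta)$ rejects tends to $1$ if $\Gamma<\max(\tilde\Gamma_b,\tilde\Gamma_n)$ and tends to $0$ if $\Gamma>\max(\tilde\Gamma_b,\tilde\Gamma_n)$.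
   Context: Data generating process. There are $I$ matched sets of $J$ subjects. The first subject of each set is a broad case and the other $J-1$ subjects are referents (not broad cases). All subjects are independent. Each subject has a treatment indicator $Z_{ij}\in\{0,1\}$ with $$\Pr(Z_{i1}=1)=\frac{b_T\pi}{b_T\pi+b_C(1-\pi)},\qquad \Pr(Z_{ij}=1)=\frac{(1-b_T)\pi}{(1-b_T)\pi+(1-b_C)(1-\pi)}\quad (j=2,\dots,J).$$ Given $Z_{i1}$, the broad case $i1$ is a narrow case with probability $\eta_T$ if $Z_{i1}=1$ and $\eta_C$ if $Z_{i1}=0$; referents are never narrow cases. (This is the law of i.i.d. subjects with $\Pr(Z=1)=\pi$, probability of being a broad case $b_T$ or $b_C$ given $Z=1$ or $Z=0$, and probability of being a narrow case given being a broad case $\eta_T$ or $\eta_C$ given $Z=1$ or $Z=0$, conditional on each set consisting of one broad case, listed first, and $J-1$ referents.) Tests. Let $Y_i=Z_{i1}$, $m_i=\sum_{j=1}^J Z_{ij}$, and let $\mathcal N$ be the (random) set of indices $i$ for which the broad case $i1$ is a narrow case. Let $Y_b=\sum_{i=1}^I Y_i$, $Y_n=\sum_{i\in\mathcal N}Y_i$, $$\bar{\bar p}_{bi}=\frac{m_i\Gamma}{m_i\Gamma+J-m_i},\qquad \bar{\bar p}_{ni}=\frac{m_i\Theta\Gamma}{m_i\Theta\Gamma+J-m_i}.$$ With $\Phi$ the standard normal distribution function, for $a\in(0,1)$ the level-$a$ broad case test with parameter $\Gamma$ rejects if $$Y_b\ge\sum_{i=1}^I\bar{\bar p}_{bi}+\Phi^{-1}(1-a)\Big\{\sum_{i=1}^I\bar{\bar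 p}_{bi}(1-\bar{\bar p}_{bi})\Big\}^{1/2},$$ and the level-$a$ narrow case test with parameters $(\Gamma,\Theta)$ rejects if $$Y_n\ge\sum_{i\in\mathcal N}\bar{\bar p}_{ni}+\Phi^{-1}(1-a)\Big\{\sum_{i\in\mathcal N}\bar{\bar p}_{ni}(1-\bar{\bar p}_{ni})\Big\}^{1/2}.$$ The level-$\alpha$ combined test with parameters $(\Gamma,\Theta)$ rejects if at least one of the level-$\alpha/2$ broad case test with parameter $\Gamma$ and the level-$\alpha/2$ narrow case test with parameters $(\Gamma,\Theta)$ rejects (equivalently, if twice the smaller of the two p-value upper bounds is at most $\alpha$). The design sensitivity of a test (for given $\Theta$) is the number $\tilde\Gamma$ such that, as $I\to\infty$, the rejection probability, when the $I$ matched sets are generated with all subjects independent, $\Pr(Z_{i1}=1)=b_T\pi/\{b_T\pi+b_C(1-\pi)\}$ for the broad cases, $\Pr(Z_{ij}=1)=(1-b_T)\pi/\{(1-b_T)\pi+(1-b_C)(1-\pi)\}$ for the referents $j=2,\dots,J$, and each broad case $i1$ being a narrow case with probability $\eta_T$ if $Z_{i1}=1$ and $\eta_C$ if $Z_{i1}=0$, tends to $1$ if $\Gamma<\tilde\Gamma$ and to $0$ if $\Gamma>\tilde\Gamma$. *)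

(* Defs.v *)
From HB Require Import structures.
From mathcomp Require Import all_boot all_order all_algebra.
From mathcomp Require Import all_classical all_reals all_analysis.

Set Implicit Arguments.
Unset Strict Implicit.
Unset Printing Implicit Defensive.

Import Order.TTheory GRing.Theory Num.Theory.
Import numFieldNormedType.Exports.

Local Open Scope classical_set_scope.
Local Open Scope ring_scope.

Definition cond_prob (R : realType) (d : measure_display)
    (T : measurableType d) (P : probability T R) (A B : set T) : R :=
  fine (P (A `&` B)) / fine (P B).

(* The product rule is required of every finite subfamily, hence the
   quantification over subsets S of the finite index type K. *)
Definition mutually_independent (R : realType) (d d' : measure_display)
    (T : measurableType d) (U : measurableType d') (P : probability T R)
    (K : finType) (X : K -> T -> U) : Prop :=
  forall (S : {set K}) (B : K -> set U), (forall k, measurable (B k)) ->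
  P (\bigcap_(k in [set` S]) (X k @^-1` B k)) =
  (\prod_(k in S) P (X k @^-1` B k))%E.

Section NormalQuantile.
Variable R : realType.

Definition std_normal_cdf (x : R) : R :=
  fine (normal_prob (0 : R) 1 `]-oo, x]).

(* For p in (0, 1) this is the unique x with std_normal_cdf x = p; the default
   value 0 is only taken outside (0, 1). *)
Definition std_normal_quantile (p : R) : R :=
  xget 0 [set x | std_normal_cdf x = p].

End NormalQuantile.

Definition first_subject (J : nat) (hJ : (1 < J)%N) : 'I_J :=
  Ordinal (ltnW hJ).

Section DataGeneratingProcess.
Variables (R : realType) (d : measure_display) (T : measurableType d).
Variables (P : probability T R) (J : nat) (hJ : (1 < J)%N).
Variables (ppi bT bC etaT etaC : R).

Definition broad_case_treatment_prob : R :=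
  bT * ppi / (bT * ppi + bC * (1 - ppi)).

Definition referent_treatment_prob : R :=
  (1 - bT) * ppi / ((1 - bT) * ppi + (1 - bC) * (1 - ppi)).

(* Z i j is the treatment indicator of subject j of set i, and N i j tells
   whether that subject is a narrow case. Subjects are independent, but the two
   coordinates (Z i j, N i j) of one subject are not. *)
Record matched_sets (I : nat) (Z N : 'I_I -> 'I_J -> {RV P >-> bool}) : Prop :=
  MatchedSets {
    matched_sets_indep :
      mutually_independent P
        (fun (ij : 'I_I * 'I_J) t => (Z ij.1 ij.2 t, N ij.1 ij.2 t));
    matched_sets_case : forall i,
      P [set t | Z i (first_subject hJ) t] = broad_case_treatment_prob%:E;
    matched_sets_referent : forall i j, j != first_subject hJ ->
      P [set t | Z i j t] = referent_treatment_prob%:E;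
    matched_sets_narrowT : forall i,
      cond_prob P [set t | N i (first_subject hJ) t]
                  [set t | Z i (first_subject hJ) t] = etaT;
    matched_sets_narrowC : forall i,
      cond_prob P [set t | N i (first_subject hJ) t]
                  [set t | ~~ Z i (first_subject hJ) t] = etaC;
    matched_sets_referent_not_narrow : forall i j, j != first_subject hJ ->
      forall t, N i j t = false
  }.

End DataGeneratingProcess.

(* The tests, as functions of the observed indicators z and n. *)
Section Tests.
Variables (R : realType) (J : nat) (hJ : (1 < J)%N) (I : nat).
Variables (z n : 'I_I -> 'I_J -> bool).

Definition treated_count (i : 'I_I) : nat := (\sum_(j < J) z i j)%N.

Definition case_treated (i : 'I_I) : R := (z i (first_subject hJ))%:R.

Definition pbarbar (G : R) (i : 'I_I) : R :=
  (treated_count i)%:R * G /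
  ((treated_count i)%:R * G + J%:R - (treated_count i)%:R).

Definition broad_case_test (a Gamma : R) : bool :=
  \sum_(i < I) pbarbar Gamma i
    + std_normal_quantile (1 - a)
      * Num.sqrt (\sum_(i < I) pbarbar Gamma i * (1 - pbarbar Gamma i))
  <= \sum_(i < I) case_treated i.

Definition is_narrow (i : 'I_I) : bool := n i (first_subject hJ).

Definition narrow_case_test (a Gamma Theta : R) : bool :=
  \sum_(i < I | is_narrow i) pbarbar (Theta * Gamma) i
    + std_normal_quantile (1 - a)
      * Num.sqrt (\sum_(i < I | is_narrow i)
          pbarbar (Theta * Gamma) i * (1 - pbarbar (Theta * Gamma) i))
  <= \sum_(i < I | is_narrow i) case_treated i.

Definition combined_test (alpha Gamma Theta : R) : bool :=
  broad_case_test (alpha / 2) Gamma || narrow_case_test (alpha / 2) Gamma Theta.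

End Tests.

(* rej Gamma I is the rejection probability, with I matched sets, of the test
   with parameter Gamma; sensitivity parameters range over [1, +oo). *)
Definition is_design_sensitivity (R : realType) (rej : R -> nat -> \bar R)
    (G : R) : Prop :=
  forall Gamma : R, 1 <= Gamma ->
    (Gamma < G -> rej Gamma @ \oo --> 1%E) /\
    (G < Gamma -> rej Gamma @ \oo --> 0%E).

Section DesignSensitivities.
Variable R : realType.

Definition broad_design_sensitivity (bT bC : R) : R :=
  (bT / (1 - bT)) / (bC / (1 - bC)).

Definition narrow_design_sensitivity (bT bC etaT etaC Theta : R) : R :=
  (bT / (1 - bT)) / (bC / (1 - bC)) * ((etaT / etaC) / Theta).

End DesignSensitivities.

(* Main.v *)
Require Import Defs.
From HB Require Import structures.
From mathcomp Require Import all_boot all_order all_algebra.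
From mathcomp Require Import perm ring lra.
From mathcomp Require Import all_classical all_reals all_analysis.

Set Implicit Arguments.
Unset Strict Implicit.
Unset Printing Implicit Defensive.

Import Order.TTheory GRing.Theory Num.Theory.
Import numFieldNormedType.Exports.

Local Open Scope classical_set_scope.
Local Open Scope ring_scope.

(** In a matched set, tilting exchangeable Bernoulli indicators by an odds ratio
    rho at the broad case makes the case treated with conditional probability
    m rho / (m rho + J - m) given the number m of treated subjects. Hence the
    mean contribution of a set to "observed minus bound" has the sign of
    rho - Gamma, where rho is the broad design sensitivity. Restricting to the
    narrow cases multiplies rho by etaT / etaC, and the bound is then taken at
    Theta Gamma, so the sign becomes that of the narrow design sensitivity minus
    Gamma. The statistic thus has a drift linear in I, while both its standard
    deviation and the normal critical value are of order sqrt I; Chebyshev's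
    inequality decides each test, whatever the value of the quantile. The
    Bonferroni combination follows by monotonicity and the union bound. *)

(** * Moments and a Chebyshev bound for finite product laws *)

Section ProductWeights.
Variables (R : realType) (B : finType) (W : B -> R) (n : nat).
Hypotheses (W_ge0 : forall b, 0 <= W b) (W_sum1 : \sum_b W b = 1).

Definition prod_weight (x : {ffun 'I_n -> B}) : R := \prod_i W (x i).

Lemma prod_weight_ge0 x : 0 <= prod_weight x.
Proof. exact: prodr_ge0. Qed.

Lemma sum_prod_weight : \sum_x prod_weight x = 1.
Proof. by rewrite -(bigA_distr_bigA (fun _ => W)) big1. Qed.

(** The factor [h] joins the product as a factor equal to 1 away from [i]; distributivity then
    splits the sum, and every other coordinate integrates to 1. *)
Lemma prod_weight_moment1 (h : B -> R) i :
  \sum_x prod_weight x * h (x i) = \sum_b W b * h b.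
Proof.
transitivity (\sum_(x : {ffun 'I_n -> B})
    \prod_k (W (x k) * (if k == i then h (x k) else 1))).
  apply: eq_bigr => x _; rewrite big_split /=; congr (_ * _).
  by rewrite -big_mkcond /= big_pred1_eq.
rewrite -(bigA_distr_bigA (fun k b => W b * (if k == i then h b else 1))).
rewrite (bigD1 i) //= eqxx [X in _ * X]big1 ?mulr1 // => k /negPf ->.
by under eq_bigr do rewrite mulr1.
Qed.

Lemma prod_weight_moment2 (g h : B -> R) i j : i != j ->
  \sum_x prod_weight x * (g (x i) * h (x j))
  = (\sum_b W b * g b) * (\sum_b W b * h b).
Proof.
move=> ij; transitivity (\sum_(x : {ffun 'I_n -> B})
    \prod_k (W (x k) * ((if k == i then g (x k) else 1)
                      * (if k == j then h (x k) else 1)))).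
  apply: eq_bigr => x _; rewrite !big_split /=; congr (_ * (_ * _));
  by rewrite -big_mkcond /= big_pred1_eq.
rewrite -(bigA_distr_bigA (fun k b => W b * ((if k == i then g b else 1)
                      * (if k == j then h b else 1)))).
rewrite (bigD1 i) //= eqxx (negPf ij) (bigD1 j) /=; last by rewrite eq_sym.
rewrite eqxx eq_sym (negPf ij) [X in _ * (_ * X)]big1 ?mulr1.
  under eq_bigr do rewrite mulr1.
  by under [X in _ * X]eq_bigr do rewrite mul1r.
move=> k /andP[/negPf -> /negPf ->].
by under eq_bigr do rewrite !mulr1.
Qed.

(** Expanding the square, the off-diagonal terms are products of two vanishing means, so only the
    [n] diagonal terms survive. *)
Lemma prod_weight_variance (g : B -> R) : \sum_b W b * g b = 0 ->
  \sum_x prod_weight x * (\sum_i g (x i)) ^+ 2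
  = n%:R * \sum_b W b * g b ^+ 2.
Proof.
move=> g0; transitivity (\sum_i \sum_j \sum_x prod_weight x * (g (x i) * g (x j))).
  rewrite (eq_bigr (fun x => \sum_i \sum_j prod_weight x * (g (x i) * g (x j)))).
    by rewrite exchange_big; apply: eq_bigr => i _; rewrite exchange_big.
  move=> x _; rewrite expr2 mulr_suml mulr_sumr; apply: eq_bigr => i _.
  by rewrite !mulr_sumr.
rewrite (eq_bigr (fun=> \sum_b W b * g b ^+ 2)).
  by rewrite sumr_const card_ord mulr_natl.
move=> i _; rewrite (bigD1 i) //= [X in _ + X]big1 ?addr0.
  by rewrite -(prod_weight_moment1 _ i); under [RHS]eq_bigr do rewrite expr2.
by move=> j ji; rewrite prod_weight_moment2 1?eq_sym // g0 mul0r.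
Qed.

(* With S the centred sum, the hypothesis on bad x yields
   mu^2 n^2 <= 2 q^2 n + 2 S^2, whose mean is O(n). *)
Lemma prod_weight_deviation (f : B -> R) (mu q : R)
    (bad : pred {ffun 'I_n -> B}) :
  mu = \sum_b W b * f b -> mu != 0 ->
  (forall x, bad x ->
     `|mu| * n%:R <= q * Num.sqrt n%:R + `|\sum_i (f (x i) - mu)|) ->
  \sum_(x | bad x) prod_weight x
  <= (2 * (q ^+ 2 + \sum_b W b * (f b - mu) ^+ 2) / mu ^+ 2 + 1) * n.+1%:R^-1.
Proof.
move=> muE mu0 hbad; set V := \sum_b W b * (f b - mu) ^+ 2.
set p := \sum_(x | bad x) _.
have V0 : 0 <= V by apply: sumr_ge0 => b _; rewrite mulr_ge0 ?sqr_ge0.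
have p1 : p <= 1.
  rewrite -sum_prod_weight /p big_mkcond /=; apply: ler_sum => x _.
  by case: ifP => _ //; exact: prod_weight_ge0.
have g0 : \sum_b W b * (f b - mu) = 0.
  under eq_bigr do rewrite mulrBr.
  by rewrite sumrB -mulr_suml W_sum1 mul1r -muE subrr.
have mu2 : 0 < mu ^+ 2 by rewrite exprn_even_gt0.
have key : mu ^+ 2 * n%:R ^+ 2 * p <= 2 * (q ^+ 2 + V) * n%:R.
  have -> : 2 * (q ^+ 2 + V) * n%:R
      = \sum_x prod_weight x
          * (2 * q ^+ 2 * n%:R + 2 * (\sum_i (f (x i) - mu)) ^+ 2).
    under eq_bigr do rewrite mulrDr [X in _ + X]mulrCA.
    rewrite big_split /= -mulr_suml -mulr_sumr.
    rewrite (prod_weight_variance (g := fun b => f b - mu)) // sum_prod_weight.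
    by rewrite -/V; ring.
  rewrite /p mulr_sumr big_mkcond /=; apply: ler_sum => x _.
  have rhs0 : 0 <= 2 * q ^+ 2 * n%:R + 2 * (\sum_i (f (x i) - mu)) ^+ 2.
    rewrite -mulrA -mulrDr mulr_ge0 // addr_ge0 ?sqr_ge0 //.
    by rewrite mulr_ge0 ?sqr_ge0.
  case: ifP => [/hbad h|_]; last by rewrite mulr_ge0 ?prod_weight_ge0.
  rewrite mulrC ler_wpM2l ?prod_weight_ge0 //.
  set S := \sum_i _ in h *.
  have : (`|mu| * n%:R) ^+ 2 <= (q * Num.sqrt n%:R + `|S|) ^+ 2.
    by rewrite lerXn2r ?nnegrE ?mulr_ge0 // (le_trans _ h) ?mulr_ge0.
  rewrite exprMn real_normK ?num_real // => /le_trans; apply.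
  have := sqr_ge0 (q * Num.sqrt n%:R - `|S|).
  have := sqr_sqrtr (ler0n R n); set s := Num.sqrt _ => <-.
  rewrite -(real_normK (num_real S)); nra.
have n1 : 0 < n.+1%:R :> R by rewrite ltr0Sn.
(* The bound is p (n + 1) = p n + p: [key] controls p n, and p <= 1 accounts for the [+ 1] in the
   constant. Dividing by n + 1 rather than n keeps n = 0 meaningful. *)
rewrite ler_pdivlMr // -natr1 mulrDr mulr1 lerD // ler_pdivlMr //.
case: (posnP n) key => [->|npos] key.
  by rewrite mulr0 mul0r mulr_ge0 ?addr_ge0 ?sqr_ge0.
have nR : 0 < n%:R :> R by rewrite ltr0n.
rewrite -(ler_pM2r nR); lra.
Qed.

(** The threshold [tau] may depend on the data but is O(sqrt n). A decision against the sign of [mu]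
    therefore forces the sum at least |mu| n - q sqrt n away from its mean, which is the deviation
    bounded above. *)
Lemma prod_weight_test (f : B -> R) (mu q : R) (tau : {ffun 'I_n -> B} -> R) :
  mu = \sum_b W b * f b ->
  (forall x, `|tau x| <= q * Num.sqrt n%:R) ->
  let C := 2 * (q ^+ 2 + \sum_b W b * (f b - mu) ^+ 2) / mu ^+ 2 + 1 in
  (0 < mu -> \sum_(x | ~~ (tau x <= \sum_i f (x i))) prod_weight x
             <= C * n.+1%:R^-1) /\
  (mu < 0 -> \sum_(x | tau x <= \sum_i f (x i)) prod_weight x
             <= C * n.+1%:R^-1).
Proof.
move=> muE htau C.
have sumB (x : {ffun 'I_n -> B}) : \sum_i (f (x i) - mu) = \sum_i f (x i) - mu * n%:R.
  by rewrite sumrB sumr_const card_ord mulr_natr.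
split=> hmu; apply: prod_weight_deviation => // [|x]; rewrite ?(gt_eqF hmu) ?(lt_eqF hmu) //.
- rewrite -ltNge sumB gtr0_norm // => h.
  have := htau x; have := ler_norm (tau x).
  have := ler_norm (- (\sum_i f (x i) - mu * n%:R)); rewrite normrN; lra.
- rewrite sumB ltr0_norm // => h.
  have := htau x; have := ler_norm (- tau x); rewrite normrN.
  have := ler_norm (\sum_i f (x i) - mu * n%:R); lra.
Qed.

End ProductWeights.

(** * Exchangeability and the mean under a tilted case *)

Section Tilting.
Variables (R : realType) (J : nat) (hJ : (1 < J)%N).

Definition count_true (z : 'I_J -> bool) : nat := (\sum_(j < J) z j)%N.

Lemma count_true_le z : (count_true z <= J)%N.
Proof.
by rewrite -[leqRHS]card_ord -sum1_card leq_sum // => j _; case: (z j).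
Qed.

(** This is [pbarbar] for a single set, written so that the two are convertible. *)
Definition treated_share (G : R) (z : 'I_J -> bool) : R :=
  (count_true z)%:R * G / ((count_true z)%:R * G + J%:R - (count_true z)%:R).

Lemma treated_share_denom_gt0 (G : R) z : 0 < G ->
  0 < (count_true z)%:R * G + J%:R - (count_true z)%:R.
Proof.
move=> G0; have := count_true_le z; rewrite -(ler_nat R).
have : 0 <= (count_true z)%:R :> R by []; have : (0 : R) < J%:R by rewrite ltr0n ltnW.
case: (posnP (count_true z)) => [->|]; first by lra.
rewrite -(ltr_nat R) => c0 _ _ cJ; have := mulr_gt0 c0 G0; lra.
Qed.

Lemma treated_share_itv (G : R) z : 0 < G -> 0 <= treated_share G z <= 1.
Proof.
move=> G0; have D := treated_share_denom_gt0 z G0.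
have := count_true_le z; rewrite -(ler_nat R) => cJ.
rewrite /treated_share divr_ge0 ?mulr_ge0 ?(ltW D) ?(ltW G0) //=.
rewrite ler_pdivrMr // mul1r; lra.
Qed.

Let perm_ffun (s : {perm 'I_J}) (z : {ffun 'I_J -> bool}) : {ffun 'I_J -> bool} :=
  [ffun i => z (s i)].

(** Reindexing by the transposition of [j0] and [j] shows that every coordinate gives the same sum;
    the identity is the average over [j]. *)
Lemma sum_coord_exchange (g : {ffun 'I_J -> bool} -> R) (j0 : 'I_J) :
  (forall (s : {perm 'I_J}) z, g (perm_ffun s z) = g z) ->
  \sum_(z : {ffun 'I_J -> bool}) (z j0)%:R * g z
  = J%:R^-1 * \sum_(z : {ffun 'I_J -> bool}) (count_true z)%:R * g z.
Proof.
move=> gsym; have J0 : J%:R != 0 :> R by rewrite pnatr_eq0 -lt0n ltnW.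
have sw j : \sum_(z : {ffun 'I_J -> bool}) (z j)%:R * g z
          = \sum_(z : {ffun 'I_J -> bool}) (z j0)%:R * g z.
  have inv : involutive (perm_ffun (tperm j0 j)).
    by move=> z; apply/ffunP => i; rewrite !ffunE tpermK.
  rewrite [RHS](reindex_inj (inv_inj inv)) /=.
  by apply: eq_bigr => z _; rewrite gsym ffunE tpermL.
transitivity (J%:R^-1 * \sum_j \sum_(z : {ffun 'I_J -> bool}) (z j)%:R * g z).
  under [X in _ * X]eq_bigr do rewrite sw.
  by rewrite sumr_const card_ord -[X in _ * X]mulr_natl mulKf.
congr (_ * _); rewrite exchange_big /=; apply: eq_bigr => z _.
by rewrite -mulr_suml /count_true natr_sum.
Qed.

(* Averaging over the coordinates replaces z j0 by count / J, after which every
   configuration contributes a nonnegative multiple of k1 - k0 * G. *)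
Lemma tilted_mean (G r s k1 k0 : R) (j0 : 'I_J) : 0 < G -> 0 < r -> 0 < s ->
  exists2 K : R, 0 < K &
  \sum_(z : {ffun 'I_J -> bool})
     (if z j0 then k1 else k0) * \prod_j (if z j then r else s)
       * ((z j0)%:R - treated_share G z) = K * (k1 - k0 * G).
Proof.
move=> G0 r0 s0; pose M (z : {ffun 'I_J -> bool}) := \prod_j (if z j then r else s).
have J0 : 0 < J%:R :> R by rewrite ltr0n ltnW.
have M0 z : 0 < M z by apply: prodr_gt0 => j _; case: ifP.
have csym (t : {perm 'I_J}) z : count_true (perm_ffun t z) = count_true z.
  rewrite /count_true [RHS](reindex_inj (@perm_inj _ t)) /=.
  by apply: eq_bigr => i _; rewrite ffunE.
have Msym (t : {perm 'I_J}) z : M (perm_ffun t z) = M z.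
  rewrite /M [RHS](reindex_inj (@perm_inj _ t)) /=.
  by apply: eq_bigr => i _; rewrite ffunE.
have psym (t : {perm 'I_J}) z : treated_share G (perm_ffun t z) = treated_share G z.
  by rewrite /treated_share csym.
pose D (z : {ffun 'I_J -> bool}) :=
  (count_true z)%:R * G + J%:R - (count_true z)%:R.
pose A (z : {ffun 'I_J -> bool}) :=
  (count_true z)%:R * (J%:R - (count_true z)%:R) / D z * M z.
have A0 z : 0 <= A z.
  rewrite mulr_ge0 ?(ltW (M0 z)) // divr_ge0 ?(ltW (treated_share_denom_gt0 z G0)) //.
  by rewrite mulr_ge0 // subr_ge0 ler_nat count_true_le.
exists (J%:R^-1 * \sum_(z : {ffun 'I_J -> bool}) A z).
  rewrite mulr_gt0 ?invr_gt0 //.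
  (* Strict positivity needs one configuration with 0 < count < J; a single treated subject gives
     one because 1 < J. *)
  pose z1 : {ffun 'I_J -> bool} := [ffun j => j == j0].
  have c1 : count_true z1 = 1%N.
    rewrite /count_true (bigD1 j0) //= ffunE eqxx big1 // => j /negPf h.
    by rewrite ffunE h.
  rewrite (bigD1 z1) //= ltr_pwDl ?sumr_ge0 //.
  rewrite mulr_gt0 // divr_gt0 ?treated_share_denom_gt0 // c1 mul1r subr_gt0.
  by rewrite ltr1n.
(* With p the treated share, the summand is k1 (1 - p) M if [z j0] holds and - k0 p M otherwise.
   Writing it as [z j0] times [g1], minus [g0], leaves both functions symmetric. *)
pose g1 (z : {ffun 'I_J -> bool}) :=
  (k1 * (1 - treated_share G z) + k0 * treated_share G z) * M z.
pose g0 (z : {ffun 'I_J -> bool}) := k0 * treated_share G z * M z.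
rewrite (eq_bigr (fun z : {ffun 'I_J -> bool} => (z j0)%:R * g1 z - g0 z)); last first.
  by move=> z _; rewrite /g1 /g0 -/(M z); case: (z j0) => /=; ring.
rewrite sumrB sum_coord_exchange; last by move=> t z; rewrite /g1 psym Msym.
have -> : \sum_(z : {ffun 'I_J -> bool}) g0 z
        = J%:R^-1 * \sum_(z : {ffun 'I_J -> bool}) J%:R * g0 z.
  by rewrite -mulr_sumr mulKf // gt_eqF.
rewrite -mulrBr -mulrA; congr (_ * _); rewrite -sumrB mulr_suml.
(* Pointwise, with c the count, 1 - p = (J - c) / D and p = c G / D, so c g1 - J g0 = A (k1 - k0
   G). *)
apply: eq_bigr => z _.
have Dn : D z != 0 by rewrite gt_eqF // treated_share_denom_gt0.
by rewrite /g1 /g0 /A /treated_share -/(D z); move: Dn; rewrite /D => Dn; field.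
Qed.

End Tilting.

(** * From independent subjects to a finite product law *)

Section JointLaw.
Variables (R : realType) (d : measure_display) (T : measurableType d).
Variables (P : probability T R) (I J : nat).
Variables (X : 'I_I * 'I_J -> T -> bool * bool) (law : 'I_J -> bool * bool -> R).
Hypotheses (X_measurable : forall k s, measurable (X k @^-1` [set s])).
Hypotheses (X_indep : mutually_independent P X).
Hypotheses (X_law : forall i j s, P (X (i, j) @^-1` [set s]) = (law j s)%:E).

Definition set_law (b : {ffun 'I_J -> bool * bool}) : R := \prod_j law j (b j).

Definition set_outcomes t : {ffun 'I_I -> {ffun 'I_J -> bool * bool}} :=
  [ffun i => [ffun j => X (i, j) t]].

Lemma set_outcomes_preimage1 x : set_outcomes @^-1` [set x] =
  \bigcap_(k in [set` [set: 'I_I * 'I_J]%SET]) X k @^-1` [set x k.1 k.2].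
Proof.
apply/seteqP; split=> t /=.
- by move=> <- [i j] _ /=; rewrite /set_outcomes !ffunE.
- move=> h; apply/ffunP => i; apply/ffunP => j; rewrite !ffunE.
  by apply: (h (i, j)); rewrite /= inE.
Qed.

(** The event is a finite disjoint union of fibres of [set_outcomes]. Each fibre is an intersection
    over all subjects, so independence for the full index set turns its probability into a
    product. *)
Lemma prob_set_outcomes (phi : pred {ffun 'I_I -> {ffun 'I_J -> bool * bool}}) :
  P [set t | phi (set_outcomes t)] = (\sum_(x | phi x) prod_weight set_law x)%:E.
Proof.
have -> : [set t | phi (set_outcomes t)] =
    \bigcup_(x in [set` enum phi]) set_outcomes @^-1` [set x].
  apply/seteqP; split=> t /=.
  - by move=> h; exists (set_outcomes t) => //=; rewrite mem_enum.
  - by move=> [x /=]; rewrite mem_enum => h ->.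
rewrite measure_fin_bigcup //; last 2 first.
- by move=> x y _ _ [t [/= <- <-]].
- move=> x _; rewrite set_outcomes_preimage1.
  by apply: fin_bigcap_measurable => // k _; exact: X_measurable.
rewrite -fsbig_seq ?enum_uniq // big_enum -sumEFin; apply: eq_bigr => x _.
rewrite set_outcomes_preimage1.
apply: etrans (X_indep [set: 'I_I * 'I_J]%SET (B := fun k => [set x k.1 k.2]) _) _.
  move=> [i j] /=; case: (x i j) => u v.
  have -> : [set (u, v)] = [set u] `*` [set v].
    by apply/seteqP; split=> [] [? ?] /= [-> ->].
  exact: measurableX.
rewrite (eq_bigr (fun k : 'I_I * 'I_J => (law k.2 (x k.1 k.2))%:E)); last first.
  by move=> [i j] _; rewrite X_law.
rewrite prodEFin; congr (_%:E).
rewrite /prod_weight /set_law pair_bigA /=.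
by apply: eq_bigl => k; rewrite inE.
Qed.

End JointLaw.

(** * The law of one matched set *)

Section SetLaw.
Variables (R : realType) (J : nat) (law : 'I_J -> bool * bool -> R).

Lemma set_law_ge0 : (forall j s, 0 <= law j s) -> forall b, 0 <= set_law law b.
Proof. by move=> h b; apply: prodr_ge0. Qed.

Lemma set_law_sum1 : (forall j, \sum_s law j s = 1) -> \sum_b set_law law b = 1.
Proof. by move=> h; rewrite -(bigA_distr_bigA law) big1. Qed.

(** Sums out the narrow indicators: a family of pairs is split into a pair of families, and the
    inner sum over the second family factors across subjects. *)
Lemma set_law_marginal (j0 : 'I_J) (h : bool -> R) (F : ('I_J -> bool) -> R) :
  \sum_b set_law law b * (h (b j0).2 * F (fun j => (b j).1)) =
  \sum_(z : {ffun 'I_J -> bool})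
    \prod_j (\sum_n law j (z j, n) * (if j == j0 then h n else 1)) * F z.
Proof.
pose w j s := law j s * (if j == j0 then h s.2 else 1).
pose merge (p : {ffun 'I_J -> bool} * {ffun 'I_J -> bool}) :
  {ffun 'I_J -> bool * bool} := [ffun j => (p.1 j, p.2 j)].
pose split_ (b : {ffun 'I_J -> bool * bool}) :=
  ([ffun j => (b j).1] : {ffun 'I_J -> bool}, [ffun j => (b j).2] : {ffun 'I_J -> bool}).
have mergeK : cancel merge split_.
  by move=> [z n]; congr (_, _); apply/ffunP => j; rewrite !ffunE.
have splitK : cancel split_ merge.
  by move=> b; apply/ffunP => j; rewrite !ffunE; case: (b j).
rewrite (reindex merge); last by exists split_ => ? _; [exact: mergeK|exact: splitK].
rewrite -(pair_bigA _ (fun z n => set_law law (merge (z, n)) *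
  (h (merge (z, n) j0).2 * F (fun j => (merge (z, n) j).1)))) /=.
apply: eq_bigr => z _.
rewrite (bigA_distr_bigA (fun j n => w j (z j, n))) mulr_suml.
apply: eq_bigr => n _; rewrite big_split /= -big_mkcond big_pred1_eq mulrA.
congr (_ * _ * _).
- by apply: eq_bigr => j _; rewrite ffunE.
- by rewrite ffunE.
- by congr F; apply/funext => j; rewrite ffunE.
Qed.

End SetLaw.

(** * The law of one subject and the mean contribution of a set *)

Section SubjectLaw.
Variables (R : realType) (J : nat) (hJ : (1 < J)%N) (a r eT eC : R).
Hypotheses (a01 : 0 < a < 1) (r01 : 0 < r < 1).
Hypotheses (eT01 : 0 < eT <= 1) (eC01 : 0 < eC <= 1).

(** The pair [s] is (treated, narrow). *)
Definition subject_law (j : 'I_J) (s : bool * bool) : R :=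
  if j == first_subject hJ then
    if s.1 then a * (if s.2 then eT else 1 - eT)
    else (1 - a) * (if s.2 then eC else 1 - eC)
  else if s.2 then 0 else if s.1 then r else 1 - r.

Lemma subject_law_ge0 j s : 0 <= subject_law j s.
Proof.
have [[a0 a1] [r0 r1] [t0 t1] [c0 c1]] :=
  And4 (andP a01) (andP r01) (andP eT01) (andP eC01).
rewrite /subject_law; case: ifP => _; case: s => [[] []] /=; nra.
Qed.

Lemma subject_law_sum1 j : \sum_s subject_law j s = 1.
Proof.
rewrite -(pair_bigA _ (fun u v => subject_law j (u, v))) /= !big_bool /=.
by rewrite /subject_law /=; case: ifP => _; ring.
Qed.

(** Relative to J independent Bernoulli(r) indicators, the case carries likelihood ratios a / r and
    (1 - a) / (1 - r), multiplied by the conditional mean of [h] given treatment. These products are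
    the tilting weights [k1] and [k0] of [tilted_mean]. *)
Lemma subject_law_mean (h : bool -> R) (G : R) : 0 < G ->
  let k1 := a * (eT * h true + (1 - eT) * h false) / r in
  let k0 := (1 - a) * (eC * h true + (1 - eC) * h false) / (1 - r) in
  exists2 K : R, 0 < K &
  \sum_b set_law subject_law b * (h (b (first_subject hJ)).2 *
     ((b (first_subject hJ)).1%:R - treated_share G (fun j => (b j).1)))
  = K * (k1 - k0 * G).
Proof.
move=> G0 k1 k0; have [r0 r1] := andP r01.
have s0 : 0 < 1 - r by rewrite subr_gt0.
have [K K0 KE] := @tilted_mean R J hJ G r (1 - r) k1 k0 (first_subject hJ) G0 r0 s0.
exists K => //; rewrite -KE.
rewrite (set_law_marginal _ _ h
  (fun z => (z (first_subject hJ))%:R - treated_share G z)).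
apply: eq_bigr => z _; congr (_ * _).
rewrite (bigD1 (first_subject hJ)) //= [in RHS](bigD1 (first_subject hJ)) //=.
rewrite mulrA; congr (_ * _).
  rewrite big_bool /subject_law eqxx /= /k1 /k0.
  by case: (z _); field; rewrite gt_eqF.
apply: eq_bigr => j /negPf j0; rewrite big_bool /subject_law j0 /= mul0r add0r.
by rewrite mulr1.
Qed.

End SubjectLaw.

(** * Identifying the law of the observed data *)

Section MatchedSetsLaw.
Variables (R : realType) (d : measure_display) (T : measurableType d).
Variables (P : probability T R).

(** Both [A] and its complement have positive probability, so the quotients in [cond_prob] can be
    multiplied back; the other two cells follow by subtraction. *)
Lemma prob_treated_narrow (A B : set T) (a e1 e0 : R) : 0 < a < 1 ->
  measurable A -> measurable B -> P A = a%:E ->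
  cond_prob P B A = e1 -> cond_prob P B (~` A) = e0 ->
  [/\ P (A `&` B) = (a * e1)%:E, P (A `\` B) = (a * (1 - e1))%:E,
      P (~` A `&` B) = ((1 - a) * e0)%:E
    & P (~` A `\` B) = ((1 - a) * (1 - e0))%:E].
Proof.
move=> /andP[a0 a1] mA mB PA.
have mAc : measurable (~` A) by exact: measurableC.
have PAc : P (~` A) = (1 - a)%:E by rewrite probability_setC // PA.
have aux (C : set T) (c e : R) : c != 0 -> measurable C -> P C = c%:E ->
    cond_prob P B C = e ->
    P (C `&` B) = (c * e)%:E /\ P (C `\` B) = (c * (1 - e))%:E.
  move=> c0 mC PC; rewrite /cond_prob PC /= setIC => <-.
  have E : P (C `&` B) = (c * (fine (P (C `&` B)) / c))%:E.
    rewrite mulrCA divff // mulr1 fineK //.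
    by rewrite fin_num_measure //; exact: measurableI.
  split=> //; have Cfin : (P C < +oo)%E by rewrite PC ltry.
  have -> : P (C `\` B) = (P C - P (C `&` B))%E by exact: measureD.
  by rewrite PC [in LHS]E -EFinB; congr (_%:E); rewrite mulrBr mulr1.
move=> h1 h0; have [? ?] := aux _ _ _ (lt0r_neq0 a0) mA PA h1.
have [//|? ?] := aux _ _ _ _ mAc PAc h0; last by split.
by rewrite gt_eqF // subr_gt0.
Qed.

Variables (J : nat) (hJ : (1 < J)%N) (ppi bT bC etaT etaC : R) (I : nat).
Variables (Z N : 'I_I -> 'I_J -> {RV P >-> bool}).
Hypothesis data : matched_sets hJ ppi bT bC etaT etaC Z N.

Let a := broad_case_treatment_prob ppi bT bC.
Let r := referent_treatment_prob ppi bT bC.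

Let X (k : 'I_I * 'I_J) t := (Z k.1 k.2 t, N k.1 k.2 t).

Lemma subject_preimage1 k u v : X k @^-1` [set (u, v)] =
  (if u then [set t | Z k.1 k.2 t] else ~` [set t | Z k.1 k.2 t]) `&`
  (if v then [set t | N k.1 k.2 t] else ~` [set t | N k.1 k.2 t]).
Proof.
rewrite /X; case: u; case: v; apply/seteqP; split=> t /=;
  case: (Z k.1 k.2 t); case: (N k.1 k.2 t); intuition (try congruence).
Qed.

Lemma measurable_RV_true (Y : {RV P >-> bool}) : measurable [set t | Y t].
Proof. exact: (measurable_funPTI Y (Y := [set true])). Qed.

Lemma subject_preimage1_measurable k s : measurable (X k @^-1` [set s]).
Proof.
case: s => u v; rewrite subject_preimage1; apply: measurableI;
  case: ifP => _; try apply: measurableC; exact: measurable_RV_true.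
Qed.

Lemma subject_preimage1_prob (a01 : 0 < a < 1) i j s :
  P (X (i, j) @^-1` [set s]) = (subject_law hJ a r etaT etaC j s)%:E.
Proof.
case: s => u v; rewrite subject_preimage1 /= /subject_law /=.
have mZ := measurable_RV_true (Z i j); have mN := measurable_RV_true (N i j).
case: eqP => [->|/eqP j0].
  have Cc : [set t | ~~ Z i (first_subject hJ) t]
          = ~` [set t | Z i (first_subject hJ) t].
    by apply/seteqP; split=> t /= /negP.
  have := matched_sets_narrowC data i; rewrite Cc => hC.
  have [] := prob_treated_narrow a01 (measurable_RV_true _) (measurable_RV_true _)
    (matched_sets_case data i) (matched_sets_narrowT data i) hC.
  by rewrite !setDE; case: u; case: v.
have N0 : [set t | N i j t] = set0.
  by apply/seteqP; split=> t //=; rewrite (matched_sets_referent_not_narrow data).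
have PZ := matched_sets_referent data i j0.
rewrite N0 setC0; case: v; first by rewrite setI0 measure0.
rewrite setIT; case: u => //; by rewrite probability_setC // PZ.
Qed.

(** Any event read off the data becomes a finite sum that no longer mentions the underlying
    probability space. *)
Lemma matched_sets_prob (a01 : 0 < a < 1)
    (phi : pred {ffun 'I_I -> {ffun 'I_J -> bool * bool}}) :
  P [set t | phi [ffun i => [ffun j => (Z i j t, N i j t)]]] =
  (\sum_(x | phi x) prod_weight (set_law (subject_law hJ a r etaT etaC)) x)%:E.
Proof.
have := prob_set_outcomes subject_preimage1_measurable (matched_sets_indep data)
  (subject_preimage1_prob a01) phi.
by [].
Qed.

End MatchedSetsLaw.

(** * Treatment probabilities and their odds ratio *)

Section Probabilities.
Variables (R : realType).

Lemma broad_case_treatment_prob_itv (ppi bT bC : R) :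
  0 < ppi < 1 -> 0 < bT < 1 -> 0 < bC < 1 ->
  0 < broad_case_treatment_prob ppi bT bC < 1.
Proof.
move=> /andP[p0 p1] /andP[t0 _] /andP[c0 _].
have tp := mulr_gt0 t0 p0; have cp : 0 < bC * (1 - ppi) by rewrite mulr_gt0 ?subr_gt0.
rewrite /broad_case_treatment_prob divr_gt0 ?addr_gt0 //=.
by rewrite ltr_pdivrMr ?addr_gt0 // mul1r ltrDl.
Qed.

Lemma referent_treatment_prob_itv (ppi bT bC : R) :
  0 < ppi < 1 -> 0 < bT < 1 -> 0 < bC < 1 ->
  0 < referent_treatment_prob ppi bT bC < 1.
Proof.
move=> hp /andP[t0 t1] /andP[c0 c1].
(* The referent probability is the case probability at the complementary rates 1 - bT and 1 - bC. *)
by apply: (@broad_case_treatment_prob_itv ppi (1 - bT) (1 - bC)) => //; lra.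
Qed.

(** Both treatment odds contain the factor ppi / (1 - ppi), which cancels in their ratio. The
    product form lets (1 - a) / (1 - r) be factored out of the means below. *)
Lemma case_referent_odds_ratio (ppi bT bC : R) :
  0 < ppi < 1 -> 0 < bT < 1 -> 0 < bC < 1 ->
  let a := broad_case_treatment_prob ppi bT bC in
  let r := referent_treatment_prob ppi bT bC in
  a / r = (1 - a) / (1 - r) * broad_design_sensitivity bT bC.
Proof.
move=> /andP[p0 p1] /andP[t0 t1] /andP[c0 c1] /=.
rewrite /broad_case_treatment_prob /referent_treatment_prob.
rewrite /broad_design_sensitivity.
have p1' : 0 < 1 - ppi by rewrite subr_gt0.
have t1' : 0 < 1 - bT by rewrite subr_gt0.
have c1' : 0 < 1 - bC by rewrite subr_gt0.
have D1 : 0 < bT * ppi + bC * (1 - ppi) by rewrite addr_gt0 ?mulr_gt0.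
have D2 : 0 < (1 - bT) * ppi + (1 - bC) * (1 - ppi) by rewrite addr_gt0 ?mulr_gt0.
have -> : 1 - bT * ppi / (bT * ppi + bC * (1 - ppi))
        = bC * (1 - ppi) / (bT * ppi + bC * (1 - ppi)).
  by field; rewrite gt_eqF.
have -> : 1 - (1 - bT) * ppi / ((1 - bT) * ppi + (1 - bC) * (1 - ppi))
        = (1 - bC) * (1 - ppi) / ((1 - bT) * ppi + (1 - bC) * (1 - ppi)).
  by field; rewrite gt_eqF.
by field; rewrite !gt_eqF.
Qed.

End Probabilities.

(** * Limits of the rejection probabilities *)

Section TestsOnOutcomes.
Variables (R : realType) (J : nat) (hJ : (1 < J)%N).

Let B := {ffun 'I_J -> bool * bool}.

Definition treatments (I : nat) (x : {ffun 'I_I -> B}) i j : bool := (x i j).1.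
Definition narrowness (I : nat) (x : {ffun 'I_I -> B}) i j : bool := (x i j).2.

(** The term of one set in observed minus bound. Taking [h] constant 1 gives the broad test; the 0/1
    value of the narrow indicator gives the narrow test as a sum over all sets, with no random index
    set. *)
Definition case_excess (h : bool -> R) (G : R) (b : B) : R :=
  h (b (first_subject hJ)).2 *
  ((b (first_subject hJ)).1%:R - treated_share G (fun j => (b j).1)).

(** Each p (1 - p) is at most 1, and at most I indices are selected, so the random set of narrow
    cases is covered uniformly. *)
Lemma sqrt_variance_le (I : nat) (A : pred 'I_I) (p : 'I_I -> R) (q : R) :
  (forall i, 0 <= p i <= 1) ->
  `|q * Num.sqrt (\sum_(i | A i) p i * (1 - p i))| <= `|q| * Num.sqrt I%:R.
Proof.
move=> p01; rewrite normrM ler_wpM2l // ger0_norm ?sqrtr_ge0 // ler_wsqrtr //.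
rewrite big_mkcond -[I in I%:R]card_ord -sumr_const ler_sum // => i _.
by case: ifP => // _; have /andP[] := p01 i; nra.
Qed.

Lemma pbarbar_itv (G : R) (I : nat) (z : 'I_I -> 'I_J -> bool) i :
  0 < G -> 0 <= pbarbar z G i <= 1.
Proof. exact: treated_share_itv. Qed.

Lemma broad_case_testE (I : nat) (a G : R) (x : {ffun 'I_I -> B}) :
  broad_case_test hJ (treatments x) a G =
  (std_normal_quantile (1 - a) * Num.sqrt
     (\sum_(i < I) pbarbar (treatments x) G i * (1 - pbarbar (treatments x) G i))
   <= \sum_i case_excess (fun=> 1) G (x i)).
Proof.
rewrite /broad_case_test -lerBrDl -sumrB; congr (_ <= _).
by apply: eq_bigr => i _; rewrite /case_excess mul1r.
Qed.

Lemma narrow_case_testE (I : nat) (a G Theta : R) (x : {ffun 'I_I -> B}) :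
  narrow_case_test hJ (treatments x) (narrowness x) a G Theta =
  (std_normal_quantile (1 - a) * Num.sqrt
     (\sum_(i < I | is_narrow hJ (narrowness x) i)
        pbarbar (treatments x) (Theta * G) i
        * (1 - pbarbar (treatments x) (Theta * G) i))
   <= \sum_i case_excess (fun n => n%:R) (Theta * G) (x i)).
Proof.
rewrite /narrow_case_test -lerBrDl -sumrB; congr (_ <= _).
rewrite big_mkcond; apply: eq_bigr => i _; rewrite /case_excess /is_narrow /narrowness.
by case: (x i _).2; rewrite ?mul1r ?mul0r.
Qed.

Variables (ppi bT bC etaT etaC : R).
Hypotheses (hpi : 0 < ppi < 1) (hbT : 0 < bT < 1) (hbC : 0 < bC < 1).
Hypotheses (hetaT : 0 < etaT <= 1) (hetaC : 0 < etaC <= 1).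

Let a := broad_case_treatment_prob ppi bT bC.
Let r := referent_treatment_prob ppi bT bC.
Let a01 : 0 < a < 1 := broad_case_treatment_prob_itv hpi hbT hbC.
Let r01 : 0 < r < 1 := referent_treatment_prob_itv hpi hbT hbC.
Let W := set_law (subject_law hJ a r etaT etaC).
Let W_ge0 : forall b, 0 <= W b := set_law_ge0 (subject_law_ge0 hJ a01 r01 hetaT hetaC).
Let W_sum1 : \sum_b W b = 1 := set_law_sum1 (subject_law_sum1 hJ a r etaT etaC).

Let pr I (phi : pred {ffun 'I_I -> B}) : R := \sum_(x | phi x) prod_weight W x.

Lemma broad_case_excess_mean (G : R) : 0 < G -> exists2 K : R, 0 < K &
  \sum_b W b * case_excess (fun=> 1) G b
  = K * (broad_design_sensitivity bT bC - G).
Proof.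
move=> G0.
have [K K0 KE] := subject_law_mean hJ a etaT etaC r01 (fun=> 1) G0.
have [/andP[a0 a1] /andP[r0 r1]] := (a01, r01).
exists (K * ((1 - a) / (1 - r))).
  by rewrite mulr_gt0 // divr_gt0 ?subr_gt0.
rewrite [LHS]KE /= !mulr1 -[RHS]mulrA; congr (_ * _).
(* With [h] constant, narrow and non-narrow probabilities add to 1, leaving k1 = a / r and k0 = (1 -
   a) / (1 - r). *)
rewrite (addrC etaT) subrK (addrC etaC) subrK !mulr1.
by rewrite (case_referent_odds_ratio hpi hbT hbC) -/a -/r mulrBr.
Qed.

Lemma narrow_case_excess_mean (Theta G : R) : 0 < Theta -> 0 < G ->
  exists2 K : R, 0 < K &
  \sum_b W b * case_excess (fun n => n%:R) (Theta * G) b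
  = K * (narrow_design_sensitivity bT bC etaT etaC Theta - G).
Proof.
move=> T0 G0; have TG0 := mulr_gt0 T0 G0.
have [K K0 KE] := subject_law_mean hJ a etaT etaC r01 (fun n => n%:R) TG0.
have [/andP[a0 a1] /andP[r0 r1]] := (a01, r01).
have [/andP[t0 _] /andP[c0 _]] := (hetaT, hetaC).
(* Here k0 = (1 - a) / (1 - r) etaC, and k1 - k0 Theta G equals k0 Theta times the narrow design
   sensitivity minus G. *)
exists (K * ((1 - a) / (1 - r) * etaC * Theta)).
  by rewrite mulr_gt0 // mulr_gt0 // mulr_gt0 // divr_gt0 ?subr_gt0.
rewrite [LHS]KE /= !mulr1 !mulr0 !addr0 -[RHS]mulrA; congr (_ * _).
rewrite mulrAC (case_referent_odds_ratio hpi hbT hbC) -/a -/r.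
rewrite /narrow_design_sensitivity -/(broad_design_sensitivity bT bC).
by field; rewrite !gt_eqF //= subr_gt0.
Qed.

Let pr_ge0 I (phi : pred {ffun 'I_I -> B}) : 0 <= pr phi.
Proof. by apply: sumr_ge0 => x _; exact: prod_weight_ge0. Qed.

Let prC I (phi : pred {ffun 'I_I -> B}) : pr phi = 1 - pr (fun x => ~~ phi x).
Proof. by rewrite -(sum_prod_weight I W_sum1) (bigID phi) addrK. Qed.

Let sub_pr I (phi psi : pred {ffun 'I_I -> B}) :
  (forall x, phi x -> psi x) -> pr phi <= pr psi.
Proof.
move=> h; rewrite /pr big_mkcond [leRHS]big_mkcond ler_sum // => x _.
case: ifP => [/h ->//|_]; case: ifP => // _; exact: prod_weight_ge0.
Qed.

Let prU I (phi psi : pred {ffun 'I_I -> B}) :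
  pr (fun x => phi x || psi x) <= pr phi + pr psi.
Proof.
rewrite /pr big_mkcond [X in X + _]big_mkcond [X in _ + X]big_mkcond -big_split.
rewrite ler_sum // => x _ /=; have := prod_weight_ge0 W_ge0 x.
by case: (phi x); case: (psi x) => /=; lra.
Qed.

Let cvg_harmonicM (C : R) : (C * n.+1%:R^-1) @[n --> \oo] --> (0 : R).
Proof.
rewrite -[X in _ --> X](mulr0 C); apply: cvgM; first exact: cvg_cst.
exact: cvg_harmonic.
Qed.

(** Shared by both tests: since K > 0, the drift has the sign of Gt - G, and the error probability
    is squeezed by a multiple of 1 / (n + 1). *)
Let sensitivity_of_test (phi : forall I, pred {ffun 'I_I -> B}) (f : B -> R)
    (q K Gt G : R) (tau : forall I, {ffun 'I_I -> B} -> R) :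
  (forall I x, phi I x = (tau I x <= \sum_i f (x i))) ->
  (forall I x, `|tau I x| <= q * Num.sqrt I%:R) ->
  0 < K -> \sum_b W b * f b = K * (Gt - G) ->
  (G < Gt -> pr (phi n) @[n --> \oo] --> (1 : R)) /\
  (Gt < G -> pr (phi n) @[n --> \oo] --> (0 : R)).
Proof.
move=> phiE htau K0 mean; set mu := \sum_b _ in mean.
have H I := prod_weight_test W_ge0 W_sum1 (erefl mu) (htau I).
split=> hG.
- have {H} H I := (H I).1 _.
  have mu0 : 0 < mu by rewrite mean mulr_gt0 // subr_gt0.
  set C := 2 * _ / _ + 1 in H.
  apply: (squeeze_cvgr (f := fun n => 1 - C * n.+1%:R^-1) (h := fun=> 1)).
  + near=> n; rewrite prC lerB //=; last first.
      rewrite /pr (eq_bigl _ _ (fun x => congr1 negb (phiE n x))); exact: H.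
    by rewrite gerBl.
  + by rewrite -[X in _ --> X]subr0; apply: cvgB; [exact: cvg_cst|exact: cvg_harmonicM].
  + exact: cvg_cst.
- have {H} H I := (H I).2 _.
  have mu0 : mu < 0 by rewrite mean pmulr_rlt0 // subr_lt0.
  set C := 2 * _ / _ + 1 in H.
  apply: (squeeze_cvgr (f := fun=> 0) (h := fun n => C * n.+1%:R^-1)).
  + near=> n; rewrite pr_ge0 /= /pr (eq_bigl _ _ (phiE n)); exact: H.
  + exact: cvg_cst.
  + exact: cvg_harmonicM.
Unshelve. all: by end_near.
Qed.

Lemma combined_test_sensitivity (alpha Theta G : R) : 0 < Theta -> 0 < G ->
  let Gt := Num.max (broad_design_sensitivity bT bC)
                    (narrow_design_sensitivity bT bC etaT etaC Theta) in
  let rej I := \sum_(x : {ffun 'I_I -> B} |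
      combined_test hJ (treatments x) (narrowness x) alpha G Theta)
      prod_weight W x in
  (G < Gt -> rej n @[n --> \oo] --> (1 : R)) /\
  (Gt < G -> rej n @[n --> \oo] --> (0 : R)).
Proof.
move=> T0 G0 Gt rej.
pose br I (x : {ffun 'I_I -> B}) := broad_case_test hJ (treatments x) (alpha / 2) G.
pose na I (x : {ffun 'I_I -> B}) :=
  narrow_case_test hJ (treatments x) (narrowness x) (alpha / 2) G Theta.
have [Kb Kb0 meanb] := broad_case_excess_mean G0.
have [Kn Kn0 meann] := narrow_case_excess_mean T0 G0.
have [b1 b0] : (G < broad_design_sensitivity bT bC -> pr (@br n) @[n --> \oo] --> (1 : R))
  /\ (broad_design_sensitivity bT bC < G -> pr (@br n) @[n --> \oo] --> (0 : R)).
  apply: (sensitivity_of_test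
    (fun I x => broad_case_testE (alpha / 2) G x) _ Kb0 meanb).
  by move=> I x; apply: (sqrt_variance_le xpredT) => i; exact: pbarbar_itv.
have [n1 n0] :
    (G < narrow_design_sensitivity bT bC etaT etaC Theta ->
       pr (@na n) @[n --> \oo] --> (1 : R))
  /\ (narrow_design_sensitivity bT bC etaT etaC Theta < G ->
       pr (@na n) @[n --> \oo] --> (0 : R)).
  apply: (sensitivity_of_test
    (fun I x => narrow_case_testE (alpha / 2) G Theta x) _ Kn0 meann).
  by move=> I x; apply: sqrt_variance_le => i; apply: pbarbar_itv; exact: mulr_gt0.
have rejE I : rej I = pr (fun x => br I x || na I x) by [].
split=> hG.
- have rej_le1 I : rej I <= 1 by rewrite rejE prC gerBl.
  (* Below the maximum one component rejects with probability tending to 1, and it bounds the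
     combined test from below. *)
  move: hG; rewrite /Gt lt_max => /orP[/b1|/n1] h;
    apply: (squeeze_cvgr (h := fun=> 1) _ h); try exact: cvg_cst;
    near=> n; rewrite rej_le1 rejE sub_pr // => x ->; by rewrite ?orbT.
(* Above the maximum both component probabilities vanish, hence so does their sum. *)
- move: hG; rewrite /Gt gt_max => /andP[/b0 hb /n0 hn].
  apply: (squeeze_cvgr (f := fun=> 0) (h := fun n => pr (@br n) + pr (@na n))).
  + by near=> n; rewrite rejE pr_ge0 prU.
  + exact: cvg_cst.
  + by rewrite -[X in _ --> X]addr0; apply: cvgD.
Unshelve. all: by end_near.
Qed.

End TestsOnOutcomes.

Theorem mainTheorem4 (R : realType) (J : nat) (hJ : (1 < J)%N)
    (alpha Theta ppi bT bC etaT etaC : R)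
    (halpha : 0 < alpha < 1) (hTheta : 1 <= Theta)
    (hpi : 0 < ppi < 1) (hbT : 0 < bT < 1) (hbC : 0 < bC < 1)
    (hetaT : 0 < etaT <= 1) (hetaC : 0 < etaC <= 1)
    (d : nat -> measure_display) (T : forall I : nat, measurableType (d I))
    (P : forall I : nat, probability (T I) R)
    (Z N : forall I : nat, 'I_I -> 'I_J -> {RV (P I) >-> bool})
    (hdata : forall I : nat,
      matched_sets hJ ppi bT bC etaT etaC (@Z I) (@N I)) :
  is_design_sensitivity
    (fun (Gamma : R) (I : nat) =>
      P I [set t | combined_test hJ (fun i j => Z I i j t)
                                    (fun i j => N I i j t) alpha Gamma Theta])
    (Num.max (broad_design_sensitivity bT bC)
             (narrow_design_sensitivity bT bC etaT etaC Theta)).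
Proof.
move=> G G1.
have G0 : 0 < G := lt_le_trans ltr01 G1.
have T0 : 0 < Theta := lt_le_trans ltr01 hTheta.
have a01 := broad_case_treatment_prob_itv hpi hbT hbC.
pose rej I := \sum_(x : {ffun 'I_I -> {ffun 'I_J -> bool * bool}} |
  combined_test hJ (treatments x) (narrowness x) alpha G Theta)
  prod_weight (set_law (subject_law hJ (broad_case_treatment_prob ppi bT bC)
    (referent_treatment_prob ppi bT bC) etaT etaC)) x.
(* The probability space changes with I; this replaces the sequence of probabilities by real finite
   sums determined by the parameters. *)
have -> : (fun I => P I [set t | combined_test hJ (fun i j => Z I i j t)
    (fun i j => N I i j t) alpha G Theta]) = (fun I => (rej I)%:E).
  apply/funext => I; rewrite /rej -(matched_sets_prob (hdata I) a01).
  congr (P I _); apply/seteqP; split=> t /=;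
    (suff -> : treatments [ffun i => [ffun j => (Z I i j t, N I i j t)]]
               = (fun i j => Z I i j t) by
     suff -> : narrowness [ffun i => [ffun j => (Z I i j t, N I i j t)]]
               = (fun i j => N I i j t) by []; apply/funext => i; apply/funext => j;
      rewrite /narrowness !ffunE);
    by apply/funext => i; apply/funext => j; rewrite /treatments !ffunE.
have [h1 h0] := combined_test_sensitivity hJ hpi hbT hbC hetaT hetaC alpha T0 G0.
by split=> hG; apply: cvg_EFin; [exact: nearW|exact: h1|exact: nearW|exact: h0].
Qed.
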